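(* Let $((G_n),(\rho_n),(\kappa_n^k))$ be a cloning system, and let $\mathscr{T}(G_\ast)$ be its Witzel-Zaremsky-Thompson group. (i) If the groups $G_n$ ($n\in\mathbb{N}$) admit left-orderings $<_n$ which are compatible with the cloning maps $\kappa_n^k$, then $\mathscr{T}(G_\ast)$ is left-orderable. (ii) Suppose that the cloning system is pure. If the groups $G_n$ ($n\in\mathbb{N}$) admit bi-orderings $<_n$ which are compatible with the cloning maps $\kappa_n^k$, then $\mathscr{T}(G_\ast)$ is bi-orderable.
   Context: Orderings. A left-ordering of a group is a total order invariant under left multiplication; a bi-ordering is a total order invariant under both left and right multiplication. A group is left-orderable (bi-orderable) if it admits a left-ordering (bi-ordering). Symmetric groups. $\mathfrak{S}_n$ is the symmetric group on $\{1,\dots,n\}$; for $g\in\mathfrak{S}_n$, $gm$ denotes the image of $m$ under $g$. Products in $\mathfrak{S}_n$ are read from left to right: $(gh)m=h(gm)$. For $1\le k\le n$ define $\varsigma_n^k\colon\mathfrak{S}_n\to\mathfrak{S}_{n+1}$ by $$\varsigma_n^k(g)m=\begin{cases} gm & \text{if } m\le k \text{ and } gm\le gk,\\ gm+1 & \text{if } m<k \text{ and } gm>gk,\\ g(m-1) & \text{if } m>k \text{ and } g(m-1)<gk,\\ g(m-1)+1 & \text{if } m>k \text{ and } g(m-1)\ge gk.\end{cases}$$ Cloning systems. Let $(G_n)_{n\in\mathbb{N}}$ be a direct system of groups, i.e. an injective homomorphism $G_n\hookrightarrow G_{n+1}$ is given for each $n$. Suppose that for each $n\in\mathbb{N}$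 a group homomorphism $\rho_n\colon G_n\to\mathfrak{S}_n$ and, for each $k=1,\dots,n$, an injective map (not necessarily a homomorphism) $\kappa_n^k\colon G_n\to G_{n+1}$ are given. The triple $((G_n),(\rho_n),(\kappa_n^k))$ is a cloning system if: (1) $\kappa_n^k(gh)=\kappa_n^k(g)\,\kappa_n^{\rho_n(g)k}(h)$ for all $g,h\in G_n$ and $1\le k\le n$; (2) $\kappa_{n+1}^{k}\circ\kappa_n^{l}=\kappa_{n+1}^{l+1}\circ\kappa_n^{k}$ for $1\le k<l\le n$; (3) for all $g\in G_n$ and $1\le k\le n$, $\rho_{n+1}(\kappa_n^k(g))$ equals $\varsigma_n^k(\rho_n(g))$ or $s_k\,\varsigma_n^k(\rho_n(g))$, where $s_k=(k,k+1)\in\mathfrak{S}_{n+1}$. The maps $\kappa_n^k$ are called the cloning maps. The cloning system is pure if $\rho_n$ is the trivial homomorphism for every $n$. The group $\mathscr{T}(G_\ast)$. A tree diagram is a triple $(T_-,g,T_+)$ where, for some $n\in\mathbb{N}$, $g\in G_n$ and $T_-,T_+$ are (finite) rooted planar binary trees with $n$ leaves, the leaves being numbered $1,\dots,n$ from left to right. A simple expansion of $(T_-,g,T_+)$ is a tree diagram $(T'_-,\kappa_n^k(g),T'_+)$ for some $1\le k\le n$, where $T'_-$ is obtained from $T_-$ by adjoining a caret to its $k$-th leaf and $T'_+$ is obtained from $T_+$ by adjoining a caret to its $(\rho_n(g)k)$-th leaf. An expansion is the result of iterated simple expansions. Two tree diagrams are equivalent if they have a common expansion; $[T_-,g,T_+]$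 denotes the equivalence class. The Witzel-Zaremsky-Thompson group $\mathscr{T}(G_\ast)$ is the set of equivalence classes of tree diagrams with the following product: given $[S_-,f,S_+]$ and $[T_-,g,T_+]$, there always exist representatives $(S'_-,f',S'_+)$ and $(T'_-,g',T'_+)$ of these classes with $S'_+=T'_-$, and the product is $[S'_-,f'g',T'_+]$; this is well defined and gives a group. Compatibility. Given a left-ordering or bi-ordering $<_n$ of $G_n$ for each $n$, the orderings are compatible with the cloning maps if, for every $n$, every $1\le k\le n$ and every $g\in G_n$, $1<_n g$ implies $1<_{n+1}\kappa_n^k(g)$. *)

(* Defs.v *)
From HB Require Import structures.
From mathcomp Require Import all_boot all_fingroup.
From mathcomp Require Import boolp.
From mathcomp Require Import zify.
From Stdlib Require Import Relation_Operators Eqdep_dec PeanoNat.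

Set Implicit Arguments.
Unset Strict Implicit.
Unset Printing Implicit Defensive.

Local Open Scope group_scope.

(* Indexing: the indices n >= 1 and the points 1, ..., n are shifted down by
   one.  Index n below stands for n + 1, so that every symmetric group is of
   the form 'S_n.+1, acting on 'I_n.+1 = {0, ..., n}.  Products in 'S_n are
   read from left to right in MathComp: (g * h) m = h (g m). *)

Section Orderings.
Variable G : groupType.
Implicit Type le : rel G.

Definition total_order le : Prop :=
  [/\ reflexive le, antisymmetric le, transitive le & total le].

Definition left_invariant le : Prop := forall z x y, le x y -> le (z * x) (z * y).
Definition right_invariant le : Prop := forall z x y, le x y -> le (x * z) (y * z).

Definition left_ordering le : Prop := total_order le /\ left_invariant le.
Definition bi_ordering le : Prop :=
  [/\ total_order le, left_invariant le & right_invariant le].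

Definition strict le : rel G := fun x y => (x != y) && le x y.

Definition left_orderable : Prop := exists le, left_ordering le.
Definition bi_orderable : Prop := exists le, bi_ordering le.

End Orderings.

(* the points k and k + 1 of {0, ..., n}, for k in {0, ..., n - 1} *)
Definition ord_same n (k : 'I_n) : 'I_n.+1 := widen_ord (leqnSn n) k.
Definition ord_next n (k : 'I_n) : 'I_n.+1 := lift ord0 k.

Section Varsigma.
Variables (n : nat) (k : 'I_n.+1) (g : 'S_n.+1).

(* The case m <= k, g m > g k forces m < k. *)
Definition varsigma_fun (m : 'I_n.+2) : 'I_n.+2 :=
  if m <= k then
    let gm := g (inord m) in
    if gm <= g k then ord_same gm else ord_next gm
  else
    let gm1 := g (inord m.-1) in
    if gm1 < g k then ord_same gm1 else ord_next gm1.

Lemma varsigma_fun_lift_perm :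
  varsigma_fun =1 lift_perm (ord_next k) (ord_next (g k)) g.
Proof.
move=> m; apply: val_inj; rewrite /varsigma_fun /ord_next.
case: (unliftP (lift ord0 k) m) => [j|] ->; last first.
  rewrite lift_perm_id /= /bump /= !add1n ltnn.
  by rewrite inord_val ltnn.
rewrite lift_perm_lift /= /bump /= !add1n.
have [kj|jk] := ltnP k j.
  rewrite add1n ltnNge (ltnW kj) /= inord_val.
  have [lt|le] := ltnP (g j) (g k); first by rewrite ltnNge ltnW.
  have -> : g k < g j; last by rewrite /= /bump.
  rewrite ltn_neqAle le andbT; apply/eqP => /val_inj /perm_inj kj'.
  by rewrite kj' ltnn in kj.
rewrite add0n jk inord_val; have [le|lt] := leqP (g j) (g k) => //=.
Qed.

Lemma varsigma_fun_inj : injective varsigma_fun.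
Proof.
by move=> x y; rewrite !varsigma_fun_lift_perm => /perm_inj.
Qed.

Definition varsigma : 'S_n.+2 := perm varsigma_fun_inj.

End Varsigma.

(* emb is the direct system; the group of equivalence classes of tree diagrams
   below does not involve it. *)
Record cloning_system := CloningSystem {
  grp :> nat -> groupType;
  emb : forall n, {multiplicative grp n -> grp n.+1};
  rho : forall n, {multiplicative grp n -> 'S_n.+1};
  kappa : forall n, 'I_n.+1 -> grp n -> grp n.+1;
  emb_inj : forall n, injective (emb n);
  kappa_inj : forall n k, injective (@kappa n k);
  kappaM : forall n k (g h : grp n),
    kappa k (g * h) = kappa k g * kappa (rho n g k) h;
  kappa_kappa : forall n (k l : 'I_n.+1) (g : grp n), k < l ->
    kappa (ord_same k) (kappa l g) = kappa (ord_next l) (kappa k g);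
  rho_kappa : forall n (k : 'I_n.+1) (g : grp n),
    rho n.+1 (kappa k g) = varsigma k (rho n g) \/
    rho n.+1 (kappa k g) = tperm (ord_same k) (ord_next k) * varsigma k (rho n g)
}.

Definition pure (C : cloning_system) : Prop := forall n (g : C n), rho C n g = 1.

Definition compatible (C : cloning_system) (le : forall n, rel (C n)) : Prop :=
  forall n (k : 'I_n.+1) (g : C n),
    strict (@le n) 1 g -> strict (@le n.+1) 1 (kappa k g).

Inductive btree := Leaf | Node of btree & btree.

Fixpoint leaves (t : btree) : nat :=
  if t is Node l r then (leaves l + leaves r)%N else 1.

(* adjoins a caret to the leaf number k (from 0, left to right) *)
Fixpoint add_caret (t : btree) (k : nat) : btree :=
  if t is Node l r then
    if k < leaves l then Node (add_caret l k) r
    else Node l (add_caret r (k - leaves l))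
  else Node Leaf Leaf.

Lemma leaves_gt0 t : 0 < leaves t.
Proof. by elim: t => //= l hl r hr; rewrite addn_gt0 hl. Qed.

Lemma leaves_add_caret t k : k < leaves t -> leaves (add_caret t k) = (leaves t).+1.
Proof.
elim: t k => [|l hl r hr] k //= lt.
by case: ltnP => kl /=; [rewrite hl // | rewrite hr; lia].
Qed.

Definition tree (n : nat) : Type := {t : btree | leaves t == n}.

Lemma caret_subproof n (t : tree n) (k : 'I_n) :
  leaves (add_caret (val t) k) == n.+1.
Proof. by case: t => t /= /eqP tn; rewrite leaves_add_caret tn. Qed.

Lemma leaves_tree n (t : tree n) : leaves (val t) = n.
Proof. exact/eqP/(valP t). Qed.

Definition caret n (t : tree n) (k : 'I_n) : tree n.+1 :=
  Sub (add_caret (val t) k) (caret_subproof t k).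

Fixpoint sub (t u : btree) : bool :=
  match t, u with
  | Leaf, _ => true
  | Node a b, Node c d => sub a c && sub b d
  | Node _ _, Leaf => false
  end.

Fixpoint sup (t u : btree) : btree :=
  match t, u with
  | Leaf, _ => u
  | Node _ _, Leaf => t
  | Node a b, Node c d => Node (sup a c) (sup b d)
  end.

Lemma sub_refl t : sub t t.
Proof. by elim: t => //= l -> r ->. Qed.

Lemma sub_trans u t v : sub t u -> sub u v -> sub t v.
Proof.
elim: u t v => [|a ha b hb] [|c d] [|e f] //= /andP[ca db] /andP[ae bf].
by rewrite (ha _ _ ca ae) (hb _ _ db bf).
Qed.

Lemma sub_supl t u : sub t (sup t u).
Proof. by elim: t u => [|a ha b hb] [|c d] //=; rewrite ?ha ?hb // !sub_refl. Qed.

Lemma sub_supr t u : sub u (sup t u).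
Proof. by elim: t u => [|a ha b hb] [|c d] //=; rewrite ?ha ?hb // !sub_refl. Qed.

Lemma sub_leaves t u : sub t u -> leaves t <= leaves u.
Proof.
elim: t u => [|a ha b hb] [|c d] //=.
  by move=> _; rewrite addn_gt0 leaves_gt0.
by case/andP => /ha ac /hb bd; rewrite leq_add.
Qed.

Lemma sub_eq t u : sub t u -> leaves u <= leaves t -> t = u.
Proof.
elim: t u => [|a ha b hb] [|c d] //=.
  by move=> _; have := leaves_gt0 c; have := leaves_gt0 d; lia.
case/andP => ac bd le; have lac := sub_leaves ac; have lbd := sub_leaves bd.
congr Node; [apply: ha => //|apply: hb => //]; clear -le lac lbd; lia.
Qed.

Lemma sub_add_caret t k : sub t (add_caret t k).
Proof.
by elim: t k => //= a ha b hb k; case: ifP => _; rewrite /= ?ha ?hb ?sub_refl.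
Qed.

Lemma sub_step t u : sub t u -> t <> u ->
  exists2 k, k < leaves t & sub (add_caret t k) u.
Proof.
elim: t u => [|a ha b hb] [|c d] //= => [_ _|]; first by exists 0.
case/andP => ac bd ne; case: (pselect (a = c)) => [eac|nac].
  case: (hb d bd) => [ebd|k lt s]; first by rewrite eac ebd in ne.
  exists (leaves a + k)%N; first by rewrite ltn_add2l.
  by rewrite ltnNge leq_addr /= addKn ac s.
have [k lt s] := ha c ac nac; exists k; first by rewrite ltn_addr.
by rewrite lt /= s bd.
Qed.

Lemma add_caretC t k l : k < l -> l < leaves t ->
  add_caret (add_caret t l) k = add_caret (add_caret t k) l.+1.
Proof.
elim: t k l => [|a ha b hb] k l kl /=; first by lia.
move=> lt; have [la|al] := ltnP l (leaves a).
  have ka := ltn_trans kl la.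
  rewrite ka /= !leaves_add_caret // [l.+1 < _]ltnS la.
  by rewrite (leq_trans ka (leqnSn _)) ha.
have [ka|ak] := ltnP k (leaves a).
  rewrite /= ka leaves_add_caret // ltnS.
  by rewrite ltnNge al /= subSS.
rewrite /= !ltnNge ak /= (leq_trans al (leqnSn l)) /= hb; [|lia|lia].
by rewrite subSn.
Qed.

Lemma sub_add_caret2 t k l u : k < l -> l < leaves t ->
  sub (add_caret t k) u -> sub (add_caret t l) u ->
  sub (add_caret (add_caret t l) k) u.
Proof.
elim: t k l u => [|a ha b hb] k l u kl /=; first by lia.
move=> lt; have [la|al] := ltnP l (leaves a).
  have ka := ltn_trans kl la; have ka' : k < (leaves a).+1 by lia.
  rewrite ka /= leaves_add_caret // ka'.
  by case: u => //= c d /andP[ka1 ->] /andP[la1 _]; rewrite (ha k l).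
have [ka|ak] := ltnP k (leaves a).
  by rewrite /= ka; case: u => //= c d /andP[-> _] /andP[_ ->].
rewrite /= ltnNge ak; case: u => //= c d /andP[-> s1] /andP[_ s2].
by rewrite hb //; lia.
Qed.

Section Diagrams.
Variable C : cloning_system.

Record diagram := Diagram {
  dsize : nat;
  dminus : tree dsize.+1;
  dgrp : C dsize;
  dplus : tree dsize.+1
}.

HB.instance Definition _ := gen_eqMixin diagram.
HB.instance Definition _ := gen_choiceMixin diagram.

Definition expand (d : diagram) (k : 'I_(dsize d).+1) : diagram :=
  Diagram (caret (dminus d) k) (kappa k (dgrp d))
          (caret (dplus d) (rho C _ (dgrp d) k)).

Definition simple_expansion (d e : diagram) : Prop := exists k, e = @expand d k.

Definition expansion : diagram -> diagram -> Prop :=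
  clos_refl_trans_1n diagram simple_expansion.

Definition equivalent (d e : diagram) : Prop :=
  exists2 x, expansion d x & expansion e x.

Lemma exp_refl d : expansion d d. Proof. exact: rt1n_refl. Qed.

Lemma exp_trans e d f : expansion d e -> expansion e f -> expansion d f.
Proof.
elim=> // x y z xy _ h zf; apply: rt1n_trans xy (h zf).
Qed.

Lemma exp_step d k : expansion d (@expand d k).
Proof. by apply: rt1n_trans (exp_refl _); exists k. Qed.

Lemma mulgg_eq1 (H : groupType) (x : H) : x * x = x -> x = 1.
Proof. by rewrite -{3}[x]mulg1 => /mulgI. Qed.

Lemma rho1 n : rho C n 1 = 1.
Proof. by apply: mulgg_eq1; rewrite -gmulfM mulg1. Qed.

Lemma kappa1 n (k : 'I_n.+1) : kappa k (1 : C n) = 1.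
Proof. by apply: mulgg_eq1; rewrite -{2}[k]perm1 -(rho1 n) -kappaM mulg1. Qed.

Lemma rhoV n g : rho C n g^-1 = (rho C n g)^-1.
Proof. by apply: (mulgI (rho C n g)); rewrite -gmulfM !mulgV rho1. Qed.

Lemma kappaV n (k : 'I_n.+1) (g : C n) :
  kappa (rho C n g k) g^-1 = (kappa k g)^-1.
Proof. by apply: (mulgI (kappa k g)); rewrite -kappaM !mulgV kappa1. Qed.

Lemma exp_square n (S T : tree n.+1) (g : C n) (k l : 'I_n.+1) : k < l ->
  @expand (@expand (Diagram S g T) l) (ord_same k) =
  @expand (@expand (Diagram S g T) k) (ord_next l).
Proof.
move=> kl; rewrite /expand /=.
have -> : caret (caret S l) (ord_same k) = caret (caret S k) (ord_next l).
  apply: val_inj; rewrite /= add_caretC //.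
  by case: S => S /= /eqP ->.
rewrite kappa_kappa //; congr Diagram; apply: val_inj => /=.
have kl_neq : k != l by rewrite neq_ltn kl.
have -> : rho C n.+1 (kappa l g) (ord_same k)
          = varsigma l (rho C n g) (ord_same k).
  case: (rho_kappa l g) => -> //; rewrite permM tpermD //.
    by apply/eqP => /(congr1 val) /=; lia.
  by apply/eqP => /(congr1 val) /=; rewrite /bump /=; lia.
have -> : rho C n.+1 (kappa k g) (ord_next l)
          = varsigma k (rho C n g) (ord_next l).
  case: (rho_kappa k g) => -> //; rewrite permM tpermD //.
  by apply/eqP => /(congr1 val) /=; rewrite /bump /=; lia.
rewrite !permE /varsigma_fun /= /bump /= add1n (ltnW kl) ltnNge (ltnW kl) /=.
rewrite !inord_val; set s := rho C n g.
have ne : (s k : nat) != s l.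
  by apply/eqP => /val_inj /perm_inj e; rewrite e ltnn in kl.
have Tl m : (s m : nat) < leaves (val T) by case: T => T /= /eqP ->.
have [lt|ge] := leqP (s k) (s l).
  by rewrite /= /bump /= add1n add_caretC //; lia.
by rewrite /= /bump /= add1n -add_caretC.
Qed.

Lemma exp_sub d e : expansion d e -> sub (val (dminus d)) (val (dminus e)).
Proof.
elim=> [x|x y z [k ->] _]; first exact: sub_refl.
by apply: sub_trans; apply: sub_add_caret.
Qed.

Lemma exp_ex_minus d u : sub (val (dminus d)) u ->
  exists2 e, expansion d e & val (dminus e) = u.
Proof.
move: {2}(leaves u - leaves (val (dminus d)))%N (leqnn (leaves u - leaves (val (dminus d))))=> m.
elim: m d => [|m IH] d le s.
  by exists d; [exact: exp_refl | apply: sub_eq; rewrite // -subn_eq0 -leqn0].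
case: (pselect (val (dminus d) = u)) => [eq|ne].
  by exists d => //; exact: exp_refl.
have [k lk sk] := sub_step s ne.
have lk' : k < (dsize d).+1 by case: (dminus d) lk => t /= /eqP <-.
pose d' := @expand d (Ordinal lk').
case: (IH d') => [||e de eu].
- by move: le; rewrite !leaves_tree /d' /=; lia.
- by rewrite /=.
by exists e => //; apply: exp_trans de; apply: exp_step.
Qed.

Lemma exp_size d e : expansion d e -> dsize d <= dsize e.
Proof. by elim=> // x y z [k ->] _ /ltnW. Qed.

Lemma exp_same_size d e : expansion d e -> dsize e <= dsize d -> e = d.
Proof. by case=> // y z [k ->] /exp_size /= h1 h2; lia. Qed.

Lemma exp_unique d e f : expansion d e -> expansion d f ->
  val (dminus e) = val (dminus f) -> e = f.
Proof.
move en : (dsize e - dsize d)%N => m.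
elim/ltn_ind: m d e f en => m IH d e f en de df eq.
have sz : dsize e = dsize f.
  by have := congr1 leaves eq; rewrite !leaves_tree => -[].
have [le|lt] := leqP (dsize e) (dsize d).
  by rewrite (exp_same_size de) // (exp_same_size df) // -sz.
case: de en lt eq sz => [|y z [k ->] yz] en lt eq sz; first by rewrite ltnn in lt.
case: df eq sz => [|y' z' [l ->] yz'] eq sz; first by rewrite sz ltnn in lt.
have szk i : dsize (@expand d i) = (dsize d).+1 by [].
suff [w [yw y'w wz]] : exists w, [/\ expansion (@expand d k) w,
    expansion (@expand d l) w & val (dminus w) = val (dminus z)].
  rewrite (IH (dsize z - (dsize d).+1)%N _ (@expand d k) z w) //; last by lia.
  apply/esym; apply: (IH (dsize z - (dsize d).+1)%N _ (@expand d l)) => //.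
  - by lia.
  - by rewrite sz.
  - by rewrite wz.
have key (i j : 'I_(dsize d).+1) : i < j ->
    sub (val (dminus (@expand d i))) (val (dminus z)) ->
    sub (val (dminus (@expand d j))) (val (dminus z)) ->
    exists w, [/\ expansion (@expand d i) w, expansion (@expand d j) w
                & val (dminus w) = val (dminus z)].
  move=> ij si sj; case: (@exp_ex_minus
      (@expand (@expand d j) (ord_same i)) (val (dminus z))) => [|w dw wz].
    by apply: sub_add_caret2 => //; rewrite leaves_tree.
  exists w; split => //; apply: exp_trans dw; last exact: exp_step.
  case: d i j ij {yz yz' en lt sz k l szk si sj} => n S g T i j ij.
  by rewrite exp_square //; apply: exp_step.
have s1 := exp_sub yz; have s2 := exp_sub yz'; rewrite -eq in s2.
case: (ltngtP k l) => [kl|lk|/val_inj kl].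
- exact: key.
- by case: (key l k lk s2 s1) => w []; exists w.
- by exists z; split => //; rewrite -kl.
Qed.

Definition dinv (d : diagram) : diagram := Diagram (dplus d) (dgrp d)^-1 (dminus d).

Lemma dinvK : involutive dinv.
Proof. by case=> n S g T; rewrite /dinv /= invgK. Qed.

Lemma exp_dinv d e : expansion d e -> expansion (dinv d) (dinv e).
Proof.
elim=> [x|x y z [k ->] _]; first exact: exp_refl.
apply: exp_trans; case: x k => n S g T k.
suff -> : dinv (@expand (Diagram S g T) k) =
          @expand (dinv (Diagram S g T)) (rho C n g k) by apply: exp_step.
rewrite /dinv /expand /= kappaV rhoV; congr Diagram.
by rewrite -permM mulgV perm1.
Qed.

Lemma exp_ex_plus d u : sub (val (dplus d)) u ->
  exists2 e, expansion d e & val (dplus e) = u.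
Proof.
move=> s; case: (@exp_ex_minus (dinv d) u s) => e /exp_dinv; rewrite dinvK => de eu.
by exists (dinv e).
Qed.

Lemma equiv_refl d : equivalent d d.
Proof. by exists d; exact: exp_refl. Qed.

Lemma equiv_sym d e : equivalent d e -> equivalent e d.
Proof. by case=> x dx ex; exists x. Qed.

Lemma equiv_trans e d f : equivalent d e -> equivalent e f -> equivalent d f.
Proof.
move=> [x dx ex] [y ey fy].
have [x' xx' ex'] := exp_ex_minus (sub_supl (val (dminus x)) (val (dminus y))).
have [y' yy' ey'] := exp_ex_minus (sub_supr (val (dminus x)) (val (dminus y))).
have e1 : x' = y'.
  apply: (@exp_unique e); last by rewrite ex' ey'.
    exact: exp_trans xx'.
  exact: exp_trans yy'.
exists x'; first exact: exp_trans xx'.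
by rewrite e1; exact: exp_trans yy'.
Qed.

Lemma exp_equiv d e : expansion d e -> equivalent d e.
Proof. by move=> de; exists e => //; exact: exp_refl. Qed.

Definition equivb : rel diagram := fun d e => `[< equivalent d e >].

Lemma equivb_refl : reflexive equivb.
Proof. by move=> d; apply/asboolP/equiv_refl. Qed.

Lemma equivb_sym : symmetric equivb.
Proof. by move=> d e; apply/asboolP/asboolP => /equiv_sym. Qed.

Lemma equivb_trans : transitive equivb.
Proof.
by move=> e d f /asboolP de /asboolP ef; apply/asboolP; apply: equiv_trans ef.
Qed.

Canonical equivb_equiv := EquivRel equivb equivb_refl equivb_sym equivb_trans.

Definition thompson : Type := {eq_quot equivb_equiv}%qT.
HB.instance Definition _ := Choice.on thompson.

Definition dclass n (S : tree n.+1) (g : C n) (T : tree n.+1) : thompson :=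
  (\pi_{eq_quot equivb_equiv} (Diagram S g T))%qT.

Lemma dclassP n (S T : tree n.+1) (g : C n) m (S' T' : tree m.+1) (g' : C m) :
  dclass S g T = dclass S' g' T' <->
  equivalent (Diagram S g T) (Diagram S' g' T').
Proof.
split; first by move/eqquotP/asboolP.
by move=> h; apply/eqquotP/asboolP.
Qed.

Lemma dclass_ex (x : thompson) : exists n (S : tree n.+1) (g : C n) (T : tree n.+1),
  x = dclass S g T.
Proof.
elim/(@quotW _ {eq_quot equivb_equiv}%qT): x => -[n S g T].
by exists n, S, g, T.
Qed.

Lemma Diagram_inj n (S S' T T' : tree n.+1) (g g' : C n) :
  Diagram S g T = Diagram S' g' T' -> [/\ S = S', g = g' & T = T'].
Proof.
move/(congr1 (fun d => existT (fun m => tree m.+1 * C m * tree m.+1)%type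
  (dsize d) (dminus d, dgrp d, dplus d))) => /= h.
by have [-> -> ->] := inj_pair2_eq_dec _ PeanoNat.Nat.eq_dec _ _ _ _ h.
Qed.

Definition dprod (d1 d2 d3 : diagram) : Prop :=
  exists n (S T U : tree n.+1) (f g : C n),
    [/\ d1 = Diagram S f T, d2 = Diagram T g U & d3 = Diagram S (f * g) U].

Lemma dprod_ex d1 d2 : val (dplus d1) = val (dminus d2) ->
  exists n (S T U : tree n.+1) (f g : C n),
    d1 = Diagram S f T /\ d2 = Diagram T g U.
Proof.
case: d1 d2 => n S f T [m T' g U] /= e.
have nm : n = m by have := congr1 leaves e; rewrite !leaves_tree => -[].
by subst m; exists n, S, T, U, f, g; split => //; congr Diagram; apply/esym/val_inj.
Qed.

Lemma dprod_unique d1 d2 d3 d3' : dprod d1 d2 d3 -> dprod d1 d2 d3' -> d3 = d3'.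
Proof.
move=> [n [S [T [U [f [g [-> -> ->]]]]]]] [m [S' [T' [U' [f' [g' [e1 e2 ->]]]]]]].
have nm := congr1 dsize e1; rewrite /= in nm; subst m.
by have [-> -> _] := Diagram_inj e1; have [_ -> ->] := Diagram_inj e2.
Qed.

Lemma exp_dprod d1 d2 d3 e1 e2 : dprod d1 d2 d3 ->
  expansion d1 e1 -> expansion d2 e2 -> val (dplus e1) = val (dminus e2) ->
  exists2 e3, dprod e1 e2 e3 & expansion d3 e3.
Proof.
move=> p de1; elim: de1 d2 d3 p => {d1 e1} [d1|d1 x e1 [k ->] xe1 IH] d2 d3 p de2 eq.
  exists d3; last exact: exp_refl.
  suff -> : e2 = d2 by [].
  apply: exp_unique de2 (exp_refl _) _; rewrite -eq.
  by case: p => n [S [T [U [f [g [-> -> _]]]]]].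
case: p k xe1 IH => n [S [T [U [f [g [-> e2' ->]]]]]] k xe1 IH; subst d2.
pose y := @expand (Diagram T g U) (rho C n f k).
have [e2' ye2' eq2] : exists2 e, expansion y e & val (dminus e) = val (dminus e2).
  apply: exp_ex_minus; rewrite -eq.
  by have := exp_sub (exp_dinv xe1).
have e22 : e2' = e2.
  by apply: exp_unique de2 eq2; apply: exp_trans ye2'; apply: exp_step.
rewrite {}e22 {eq2} in ye2'.
have [|e3 h1 h2] := IH y (@expand (Diagram S (f * g) U) k) _ ye2' eq.
  exists n.+1, (caret S k), (caret T (rho C n f k)),
    (caret U (rho C n g (rho C n f k))), (kappa k f), (kappa (rho C n f k) g).
  by split => //; rewrite /expand /= kappaM gmulfM permM.
by exists e3 => //; apply: exp_trans h2; apply: exp_step.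
Qed.

Lemma dprod_equiv d1 d2 d3 d1' d2' d3' : dprod d1 d2 d3 -> dprod d1' d2' d3' ->
  equivalent d1 d1' -> equivalent d2 d2' -> equivalent d3 d3'.
Proof.
move=> p p' [x1 dx1 dx1'] [x2 dx2 dx2'].
have [e1 xe1 v1] := exp_ex_plus (sub_supl (val (dplus x1)) (val (dminus x2))).
have [e2 xe2 v2] := exp_ex_minus (sub_supr (val (dplus x1)) (val (dminus x2))).
have v : val (dplus e1) = val (dminus e2) by rewrite v1 v2.
have [e3 q q3] := exp_dprod p (exp_trans dx1 xe1) (exp_trans dx2 xe2) v.
have [e3' q' q3'] := exp_dprod p' (exp_trans dx1' xe1) (exp_trans dx2' xe2) v.
by exists e3 => //; rewrite (dprod_unique q q').
Qed.

(* The representatives of x and y exist (is_prod_ex), and z does not depend on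
   them (is_prod_unique). *)
Definition is_prod (x y z : thompson) : Prop :=
  exists n (S T U : tree n.+1) (f g : C n),
    [/\ x = dclass S f T, y = dclass T g U & z = dclass S (f * g) U].

Lemma dclass_exp d e : expansion d e ->
  dclass (dminus d) (dgrp d) (dplus d) = dclass (dminus e) (dgrp e) (dplus e).
Proof. by case: d e => n S g T [m S' g' T'] h; apply/dclassP/exp_equiv. Qed.

Lemma is_prod_ex (x y : thompson) : exists z, is_prod x y z.
Proof.
have [n [S [f [T ->]]]] := dclass_ex x; have [m [T' [g [U ->]]]] := dclass_ex y.
have [e1 de1 v1] := @exp_ex_plus (Diagram S f T) _ (sub_supl (val T) (val T')).
have [e2 de2 v2] := @exp_ex_minus (Diagram T' g U) _ (sub_supr (val T) (val T')).
have [|l [A [B [D [a [b [E1 E2]]]]]]] := @dprod_ex e1 e2; first by rewrite v1 v2.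
exists (dclass A (a * b) D), l, A, B, D, a, b; subst e1 e2.
by split => //; [apply: (dclass_exp de1)|apply: (dclass_exp de2)].
Qed.

Lemma is_prod_unique x y z z' : is_prod x y z -> is_prod x y z' -> z = z'.
Proof.
move=> [n [S [T [U [f [g [-> -> ->]]]]]]] [m [S' [T' [U' [f' [g' [e1 e2 ->]]]]]]].
move/dclassP: e1 => e1; move/dclassP: e2 => e2; apply/dclassP.
by apply: dprod_equiv e1 e2; [exists n, S, T, U, f, g|exists m, S', T', U', f', g'].
Qed.

Definition thompson_mul (x y : thompson) : thompson := projT1 (cid (is_prod_ex x y)).

Lemma thompson_mulE n (S T U : tree n.+1) (f g : C n) :
  thompson_mul (dclass S f T) (dclass T g U) = dclass S (f * g) U.
Proof.
rewrite /thompson_mul; case: cid => z /= h.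
by apply: is_prod_unique h _; exists n, S, T, U, f, g.
Qed.

Lemma leaf_subproof : leaves Leaf == 1%N. Proof. by []. Qed.
Definition leaf_tree : tree 1 := Sub Leaf leaf_subproof.

Definition thompson_one : thompson := dclass leaf_tree 1 leaf_tree.

Lemma exp_one d e : expansion d e ->
  (exists n (S : tree n.+1), d = Diagram S 1 S) ->
  exists n (S : tree n.+1), e = Diagram S 1 S.
Proof.
elim=> // x y z [k ->] _ IH [n [S xS]]; subst x; apply: IH.
by exists n.+1, (caret S k); rewrite /expand /= kappa1 rho1 perm1.
Qed.

Lemma thompson_oneE n (S : tree n.+1) : dclass S 1 S = thompson_one.
Proof.
have [e de es] := @exp_ex_minus (Diagram leaf_tree 1 leaf_tree) (val S) isT.
have [|m [S' e']] := exp_one de; first by exists 0, leaf_tree.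
subst e; have nm : n = m.
  by have := congr1 leaves es; rewrite !leaves_tree => -[].
by subst m; rewrite /= in es; rewrite -(val_inj es); exact/esym/(dclass_exp de).
Qed.

Definition thompson_inv (x : thompson) : thompson :=
  let d := generic_quotient.repr x in dclass (dplus d) (dgrp d)^-1 (dminus d).

Lemma thompson_invE n (S T : tree n.+1) (g : C n) :
  thompson_inv (dclass S g T) = dclass T g^-1 S.
Proof.
rewrite /thompson_inv; set d := generic_quotient.repr _.
have : dclass (dminus d) (dgrp d) (dplus d) = dclass S g T.
  by rewrite -[RHS]reprK -/d; case: d.
case: d => m S' g' T' /dclassP [x /exp_dinv h1 /exp_dinv h2] /=.
by apply/dclassP; exists (dinv x).
Qed.

Lemma thompson_mulA : associative thompson_mul.
Proof.
move=> x y z.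
have [yz h] := is_prod_ex y z; move: h => [n [S [T [U [f [g [-> -> _]]]]]]].
have [m [A [a [B ->]]]] := dclass_ex x.
have [e1 de1 v1] := @exp_ex_plus (Diagram A a B) _ (sub_supl (val B) (val S)).
have [e2 de2 v2] := @exp_ex_minus (Diagram S f T) _ (sub_supr (val B) (val S)).
have [e3 de3 v3] := @exp_ex_minus (Diagram T g U) (val (dplus e2))
  (exp_sub (exp_dinv de2)).
have [|l [P [Q [R [p [q [E1 E2]]]]]]] := @dprod_ex e1 e2; first by rewrite v1 v2.
have [|l' [P' [Q' [R' [p' [q' [E2' E3]]]]]]] := @dprod_ex e2 e3; first by rewrite v3.
have nm : l = l' by move: E2' (congr1 dsize E2) => -> /= ->.
subst l' e2 e1 e3; have [? ? ?] := Diagram_inj E2'; subst P' p' Q'.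
rewrite (dclass_exp de1) (dclass_exp de2) (dclass_exp de3) /=.
by rewrite !thompson_mulE mulgA.
Qed.

Lemma thompson_mul1g : left_id thompson_one thompson_mul.
Proof.
move=> x; have [n [S [f [T ->]]]] := dclass_ex x.
by rewrite -(thompson_oneE S) thompson_mulE mul1g.
Qed.

Lemma thompson_mulg1 : right_id thompson_one thompson_mul.
Proof.
move=> x; have [n [S [f [T ->]]]] := dclass_ex x.
by rewrite -(thompson_oneE T) thompson_mulE mulg1.
Qed.

Lemma thompson_mulVg : left_inverse thompson_one thompson_inv thompson_mul.
Proof.
move=> x; have [n [S [f [T ->]]]] := dclass_ex x.
by rewrite thompson_invE thompson_mulE mulVg thompson_oneE.
Qed.

Lemma thompson_mulgV : right_inverse thompson_one thompson_inv thompson_mul.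
Proof.
move=> x; have [n [S [f [T ->]]]] := dclass_ex x.
by rewrite thompson_invE thompson_mulE mulgV thompson_oneE.
Qed.

HB.instance Definition _ := isGroup.Build thompson
  thompson_mulA thompson_mul1g thompson_mulg1 thompson_mulVg thompson_mulgV.

End Diagrams.

(* Main.v *)
(** Record a tree by the sequence of the depths of its leaves, and order trees
    with the same number of leaves lexicographically by these sequences.
    Adjoining carets to the k-th leaves of two trees preserves this order.

    (i) Call [S, g, T] positive if 1 < g, or if g = 1 and S < T.

    (ii) Call [S, g, T] positive if S < T, or if S = T and 1 < g.  In the pure
    case expansions adjoin carets to S and T at the same leaves.  The comparison
    of S and T amounts to the slope, at the first point where it is not 1, of
    the element of Thompson's group F given by S and T, which is why it is
    invariant under conjugation. *)
Require Import Defs.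
From mathcomp Require Import all_boot all_fingroup all_order.
From mathcomp Require Import boolp zify.

Set Implicit Arguments.
Unset Strict Implicit.
Unset Printing Implicit Defensive.

Import Order.Theory.
Local Open Scope group_scope.

(** * Orderings defined by a positive cone *)

Section PositiveCone.
Variables (G : groupType) (P : G -> Prop).
Hypothesis PM : forall x y, P x -> P y -> P (x * y).
Hypothesis P1 : ~ P 1.
Hypothesis PV : forall x, [\/ x = 1, P x | P x^-1].

Definition cone_le : rel G := fun x y => `[< x = y \/ P (x^-1 * y) >].

(** Left multiplication does not change [x^-1 * y]. Antisymmetry comes from [PM] and [P1],
    transitivity from [PM], totality from [PV]. *)
Lemma cone_left_ordering : left_ordering cone_le.
Proof.
split; last first.
  move=> z x y /asboolP[->|h]; apply/asboolP; first by left.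
  by right; rewrite invMg -mulgA mulKg.
split.
- by move=> x; apply/asboolP; left.
- move=> x y /andP[/asboolP[//|h1] /asboolP[//|h2]]; case: P1.
  by have := PM h1 h2; rewrite -mulgA mulKVg mulVg.
- move=> y x z /asboolP[->//|h1] /asboolP[<-|h2]; apply/asboolP; right => //.
  by have := PM h1 h2; rewrite -mulgA mulKVg.
- move=> x y; apply/orP; case: (PV (x^-1 * y)) => h.
  + left; apply/asboolP; left.
    by apply: (mulgI x^-1); rewrite h mulVg.
  + by left; apply/asboolP; right.
  + by right; apply/asboolP; right; move: h; rewrite invMg invgK.
Qed.

(** Since [y * x] is the conjugate of [x * y] by [x], the hypothesis says that [P] is conjugation
    invariant, and right multiplication by [z] conjugates [x^-1 * y] by [z]. *)
Lemma cone_bi_ordering : (forall x y, P (x * y) -> P (y * x)) -> bi_ordering cone_le.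
Proof.
move=> PC; have [tot inv] := cone_left_ordering; split=> // z x y /asboolP[->|h].
  by apply/asboolP; left.
apply/asboolP; right; rewrite invMg -mulgA; apply: PC.
by rewrite -!mulgA mulgV mulg1.
Qed.

End PositiveCone.

(** * Positive elements of an ordered group *)

Section OrderedGroup.
Variables (G : groupType) (le : rel G).
Hypothesis le_left : left_ordering le.

Lemma strict_mul x y : strict le 1 x -> strict le 1 y -> strict le 1 (x * y).
Proof.
case: le_left => -[_ le_anti le_trans _] le_mul /andP[nx x0] /andP[_ y0].
have xy : le x (x * y) by have := le_mul x _ _ y0; rewrite mulg1.
rewrite /strict (le_trans _ _ _ x0 xy) andbT; apply/eqP => e.
by move: nx; rewrite (le_anti 1 x) ?eqxx // x0 e.
Qed.

Lemma strict_trichotomy x : [\/ x = 1, strict le 1 x | strict le 1 x^-1].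
Proof.
case: le_left => -[_ _ _ le_total] le_mul.
case: (eqVneq x 1) => [->|nx]; first by constructor 1.
case/orP: (le_total 1 x) => h; [constructor 2 | constructor 3].
  by rewrite /strict eq_sym nx.
have := le_mul x^-1 _ _ h; rewrite mulVg mulg1 /strict => ->; rewrite andbT.
by apply: contra nx => /eqP e; rewrite -[x]invgK -e invg1.
Qed.

Lemma strict_conj x y : right_invariant le ->
  strict le 1 (x * y) -> strict le 1 (y * x).
Proof.
case: le_left => _ le_mul le_mulr /andP[nxy h]; apply/andP; split.
  apply: contra nxy => /eqP e; apply/eqP; apply: (mulgI y).
  by rewrite mulgA -e mulg1 mul1g.
have := le_mulr x _ _ (le_mul x^-1 _ _ h).
by rewrite mulKg mulg1 mulVg.
Qed.

End OrderedGroup.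

(** * Depth sequences of trees and their lexicographic order *)

Fixpoint depths (d : nat) (t : btree) : seq nat :=
  if t is Node l r then depths d.+1 l ++ depths d.+1 r else [:: d].

(** The depth of the leftmost leaf, which gives the first entry of a depth sequence. *)
Fixpoint spine (t : btree) : nat := if t is Node l _ then (spine l).+1 else 0.

Lemma depths_spine d t : exists s, depths d t = (d + spine t)%N :: s.
Proof.
elim: t d => [|l hl r _] d /=; first by exists [::]; rewrite addn0.
by have [s ->] := hl d.+1; exists (s ++ depths d.+1 r); rewrite addSnnS.
Qed.

Lemma size_depths d t : size (depths d t) = leaves t.
Proof. by elim: t d => //= l hl r hr d; rewrite size_cat hl hr. Qed.

(** A leaf at depth [d] contributes the entry [d], while the sequence of a node starts with a larger
    entry; so a depth sequence shows where its tree ends. *)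
Lemma depths_prefix_free d a b x y :
  depths d a ++ x = depths d b ++ y -> a = b /\ x = y.
Proof.
elim: a d b x y => [|a1 h1 a2 h2] d [|b1 b2] x y.
- by case.
- by have [s /= ->] := depths_spine d (Node b1 b2) => -[]; lia.
- by have [s /= ->] := depths_spine d (Node a1 a2) => -[]; lia.
- by rewrite /= -!catA => /h1[-> /h2[-> ->]].
Qed.

Lemma depths_inj d : injective (depths d).
Proof.
move=> a b e; suff [] : a = b /\ [::] = [::] :> seq nat by [].
by apply: (@depths_prefix_free d); rewrite e.
Qed.

Fixpoint split_depth (s : seq nat) (k : nat) : seq nat :=
  match s, k with
  | [::], _ => [::]
  | x :: s', 0 => [:: x.+1, x.+1 & s']
  | x :: s', k'.+1 => x :: split_depth s' k'
  end.

Lemma split_depth_cat s u k : split_depth (s ++ u) k =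
  if k < size s then split_depth s k ++ u else s ++ split_depth u (k - size s).
Proof.
elim: s k => [|x s IH] [|k] //=; rewrite IH ltnS subSS.
by case: ifP.
Qed.

Lemma depths_add_caret d t k : k < leaves t ->
  depths d (add_caret t k) = split_depth (depths d t) k.
Proof.
elim: t d k => [|l hl r hr] d k /=; first by case: k.
move=> lt; rewrite split_depth_cat size_depths.
by case: ltnP => h /=; rewrite ?hl // hr //; lia.
Qed.

Definition lexlt (s u : seq nat) : bool := ((s : seqlexi nat) < (u : seqlexi nat))%O.

Lemma lexlt_cons x y s u :
  lexlt (x :: s) (y :: u) = (x < y) || (x == y) && lexlt s u.
Proof.
by rewrite /lexlt Order.SeqLexiOrder.ltxi_cons !leEnat; case: ltngtP.
Qed.

Lemma lexlt_cat s u v : lexlt (s ++ u) (s ++ v) = lexlt u v.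
Proof. by elim: s => //= x s IH; rewrite lexlt_cons ltnn eqxx. Qed.

(** Splitting before the first difference inserts equal entries, splitting at it turns [x < y] into
    [x.+1 < y.+1], and splitting after it comes too late to matter. *)
Lemma lexlt_split_depth s u k : size s = size u ->
  lexlt s u -> lexlt (split_depth s k) (split_depth u k).
Proof.
elim: s u k => [|x s IH] [|y u] [|k] //= [sz]; rewrite !lexlt_cons.
  case/orP => [lt|/andP[/eqP -> ->]]; first by rewrite ltnS lt.
  by rewrite !eqxx !orbT.
by case/orP => [->//|/andP[/eqP -> /(IH _ k sz) ->]]; rewrite eqxx orbT.
Qed.

(** * Attaching trees to the leaves of a tree *)

(* The depths of the leaves of the tree obtained by attaching the trees fs to
   the leaves, of depths s, of a given tree. *)
Fixpoint graft (s : seq nat) (fs : seq btree) : seq nat :=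
  match s, fs with
  | d :: s', f :: fs' => depths d f ++ graft s' fs'
  | _, _ => [::]
  end.

Lemma graft_leaf n s : size s = n -> graft s (nseq n Leaf) = s.
Proof. by move=> <-; elim: s => //= x s ->. Qed.

(** Moves a caret at leaf [k] of the base tree into the attached trees: those at its two leaves
    become one tree attached at leaf [k]. *)
Fixpoint merge_at (fs : seq btree) (k : nat) : seq btree :=
  match k, fs with
  | 0, [:: a, b & fs'] => Node a b :: fs'
  | k'.+1, a :: fs' => a :: merge_at fs' k'
  | _, _ => [::]
  end.

Lemma size_merge_at fs k : k.+1 < size fs -> size (merge_at fs k) = (size fs).-1.
Proof.
elim: fs k => [|a fs IH] [|k] //=; first by case: fs {IH}.
by rewrite ltnS => h; rewrite IH // prednK //; lia.
Qed.

Lemma graft_split_depth s fs k : size fs = (size s).+1 -> k < size s ->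
  graft (split_depth s k) fs = graft s (merge_at fs k).
Proof.
elim: s fs k => [|x s IH] [|a fs] [|k] //= [sz] lt.
  by case: fs sz => //= b fs _; rewrite catA.
by rewrite IH.
Qed.

(* At the first index where s and u differ, the tree of a has a longer left
   spine than the tree of b. *)
Lemma lexlt_graft_swap s u t a b :
  size u = size s -> size t = size s -> size a = size s -> size b = size s ->
  lexlt s u -> graft s a = graft u b -> lexlt (graft t b) (graft t a).
Proof.
elim: s u t a b => [|x s IH] [|y u] [|z t] [|f a] [|g b] //=.
move=> [su] [st] [sa] [sb]; rewrite lexlt_cons => /orP[lt|/andP[/eqP <- lt]].
  have [r1 ->] := depths_spine x f; have [r2 ->] := depths_spine y g.
  have [r3 ->] := depths_spine z f; have [r4 ->] := depths_spine z g.
  by move=> /= [e _]; rewrite lexlt_cons; apply/orP; left; lia.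
(* At equal depths the first attached trees coincide and cancel. *)
by move/depths_prefix_free => [-> e]; rewrite lexlt_cat (IH u).
Qed.

(** * The order on trees with [n] leaves *)

Definition tree_lt n (S T : tree n) : bool :=
  lexlt (depths 0 (val S)) (depths 0 (val T)).

Lemma size_tree_depths n (S : tree n) d : size (depths d (val S)) = n.
Proof. by rewrite size_depths leaves_tree. Qed.

Lemma tree_ltxx n (S : tree n) : tree_lt S S = false.
Proof. exact: ltxx. Qed.

Lemma tree_lt_trans n (S T U : tree n) : tree_lt S T -> tree_lt T U -> tree_lt S U.
Proof. exact: lt_trans. Qed.

Lemma tree_lt_trichotomy n (S T : tree n) : [\/ S = T, tree_lt S T | tree_lt T S].
Proof.
rewrite /tree_lt /lexlt.
have [h|h|h] := ltgtP (depths 0 (val S) : seqlexi nat) (depths 0 (val T)).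
- by constructor 2.
- by constructor 3.
- by constructor 1; apply/val_inj/(depths_inj h).
Qed.

Lemma depths_caret n (S : tree n) (k : 'I_n) d :
  depths d (val (caret S k)) = split_depth (depths d (val S)) k.
Proof. by rewrite depths_add_caret // leaves_tree. Qed.

Lemma tree_lt_caret n (S T : tree n) (k : 'I_n) :
  tree_lt S T -> tree_lt (caret S k) (caret T k).
Proof.
rewrite /tree_lt !depths_caret => h.
by apply: lexlt_split_depth => //; rewrite !size_tree_depths.
Qed.

(** * From positive diagrams to a positive cone of classes *)

Section DiagramCone.
Variables (C : cloning_system) (pos : diagram C -> Prop).
Hypothesis pos_expand : forall d (k : 'I_(dsize d).+1), pos d -> pos (expand k).
Hypothesis pos_prod : forall n (S T U : tree n.+1) (f g : C n),
  pos (Diagram S f T) -> pos (Diagram T g U) -> pos (Diagram S (f * g) U).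
Hypothesis pos_one : forall n (S : tree n.+1), ~ pos (Diagram S (1 : C n) S).
Hypothesis pos_trichotomy : forall n (S T : tree n.+1) (g : C n),
  [\/ S = T /\ g = 1, pos (Diagram S g T) | pos (Diagram T g^-1 S)].

Lemma pos_expansion d e : expansion d e -> pos d -> pos e.
Proof. by elim=> // x y z [k ->] _ IH /pos_expand/IH. Qed.

Definition class_pos (x : thompson C) : Prop :=
  exists n (S T : tree n.+1) (g : C n), x = dclass S g T /\ pos (Diagram S g T).

Lemma class_posI n (S T : tree n.+1) (g : C n) :
  pos (Diagram S g T) -> class_pos (dclass S g T).
Proof. by exists n, S, T, g. Qed.

Lemma class_posM x y : class_pos x -> class_pos y -> class_pos (x * y).
Proof.
move=> [n [S [T [f [-> p1]]]]] [m [T' [U [g [-> p2]]]]].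
(* Both diagrams are expanded until their middle trees become [sup T T']; positivity survives
   expansion. *)
have [e1 de1 v1] := @exp_ex_plus C (Diagram S f T) _ (sub_supl (val T) (val T')).
have [e2 de2 v2] := @exp_ex_minus C (Diagram T' g U) _ (sub_supr (val T) (val T')).
have [|l [A [B [D [a [b [E1 E2]]]]]]] := @dprod_ex C e1 e2; first by rewrite v1 v2.
subst e1 e2; rewrite (dclass_exp de1) (dclass_exp de2) /=.
have -> : dclass A a B * dclass B b D = dclass A (a * b) D by exact: thompson_mulE.
apply: class_posI; apply: (@pos_prod _ _ B).
  exact: pos_expansion de1 p1.
exact: pos_expansion de2 p2.
Qed.

(** A positive representative of 1 shares an expansion with the trivial diagram, and that expansion
    has the form [Diagram S' 1 S']. *)
Lemma class_pos1 : ~ class_pos 1.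
Proof.
move=> [n [S [T [g [/dclassP[x ox dx] p]]]]].
have [|m [S' e]] := exp_one ox; first by exists 0, leaf_tree.
by have := pos_expansion dx p; rewrite e; apply: pos_one.
Qed.

Lemma class_pos_trichotomy x : [\/ x = 1, class_pos x | class_pos x^-1].
Proof.
have [n [S [g [T ->]]]] := dclass_ex x.
have [[-> ->]|p|p] := pos_trichotomy S T g.
- by constructor 1; apply: thompson_oneE.
- by constructor 2; apply: class_posI.
- constructor 3; have -> : (dclass S g T)^-1 = dclass T g^-1 S by exact: thompson_invE.
  exact: class_posI.
Qed.

(** Positivity does not depend on the representative: otherwise, by trichotomy, the class is trivial
    or its inverse is positive too, and 1 would be positive. *)
Lemma class_posE n (S T : tree n.+1) (g : C n) :
  class_pos (dclass S g T) -> pos (Diagram S g T).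
Proof.
move=> p; have [[eS eg]|//|q] := pos_trichotomy S T g.
  by case: class_pos1; rewrite eS eg thompson_oneE in p.
case: class_pos1; rewrite -(mulgV (dclass S g T)); apply: class_posM => //.
have -> : (dclass S g T)^-1 = dclass T g^-1 S by exact: thompson_invE.
exact: class_posI.
Qed.

End DiagramCone.

(** * The left-ordering: group element first, then trees *)

Section LeftOrdering.
Variables (C : cloning_system) (le : forall n, rel (C n)).
Hypothesis le_left : forall n, left_ordering (@le n).
Hypothesis le_compat : compatible le.

Definition left_pos (d : diagram C) : Prop :=
  strict (@le _) 1 (dgrp d) \/ (dgrp d = 1 /\ tree_lt (dminus d) (dplus d)).

Lemma thompson_left_orderable : left_orderable (thompson C).
Proof.
have expd d (k : 'I_(dsize d).+1) : left_pos d -> left_pos (expand k).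
  case=> [h|[e h]]; first by left; apply: le_compat.
  (* For trivial group element both carets go to leaf [k]. *)
  by right; rewrite /= e kappa1 rho1 perm1; split => //; apply: tree_lt_caret.
have prod n (S T U : tree n.+1) (f g : C n) : left_pos (Diagram S f T) ->
    left_pos (Diagram T g U) -> left_pos (Diagram S (f * g) U).
  rewrite /left_pos /=; move=> [hf|[-> ST]] [hg|[-> TU]].
  - by left; apply: strict_mul.
  - by left; rewrite mulg1.
  - by left; rewrite mul1g.
  - by right; rewrite mulg1; split => //; apply: tree_lt_trans TU.
have one n (S : tree n.+1) : ~ left_pos (Diagram S (1 : C n) S).
  by case=> /= [/andP[/eqP]|[_]]; rewrite ?tree_ltxx.
have tri n (S T : tree n.+1) (g : C n) :
    [\/ S = T /\ g = 1, left_pos (Diagram S g T) | left_pos (Diagram T g^-1 S)].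
  have [->|h|h] := strict_trichotomy (le_left n) g; last 2 first.
  - by constructor 2; left.
  - by constructor 3; left.
  have [->|h|h] := tree_lt_trichotomy S T.
  - by constructor 1.
  - by constructor 2; right.
  - by constructor 3; right; rewrite /= invg1.
exists (cone_le (class_pos left_pos)); apply: cone_left_ordering.
- exact: class_posM.
- exact: class_pos1.
- exact: class_pos_trichotomy.
Qed.

End LeftOrdering.

(** * The bi-ordering in the pure case: trees first, then group element *)

Section BiOrdering.
Variables (C : cloning_system) (le : forall n, rel (C n)).
Hypothesis C_pure : pure C.
Hypothesis le_bi : forall n, bi_ordering (@le n).
Hypothesis le_compat : compatible le.

(** As [rho] is trivial, every caret goes to the same leaf number on both sides, so the same forest
    [fs] is attached to both trees. *)
Lemma pure_expansion_graft (d e : diagram C) : expansion d e ->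
  exists fs, [/\ size fs = (dsize d).+1,
    depths 0 (val (dminus e)) = graft (depths 0 (val (dminus d))) fs &
    depths 0 (val (dplus e)) = graft (depths 0 (val (dplus d))) fs].
Proof.
elim=> [x|x y z [k ->] _ [fs [sz em ep]]].
  exists (nseq (dsize x).+1 Leaf); split; first by rewrite size_nseq.
    by rewrite graft_leaf // size_tree_depths.
  by rewrite graft_leaf // size_tree_depths.
rewrite /= in sz.
(* Here [fs] describes the expansion after its first step; merging at [k] absorbs the caret of that
   step. *)
exists (merge_at fs k); split; first by rewrite size_merge_at ?sz // ltnS ltn_ord.
  by rewrite em depths_caret graft_split_depth // size_tree_depths.
by rewrite ep [dplus _]/= C_pure perm1 depths_caret graft_split_depth // size_tree_depths.
Qed.

Definition bi_pos (d : diagram C) : Prop :=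
  tree_lt (dminus d) (dplus d) \/
  (dminus d = dplus d /\ strict (@le _) 1 (dgrp d)).

Lemma le_left n : left_ordering (@le n).
Proof. by case: (le_bi n). Qed.

Lemma bi_pos_expand d (k : 'I_(dsize d).+1) : bi_pos d -> bi_pos (expand k).
Proof.
case=> [h|[e h]]; rewrite /bi_pos /= C_pure perm1.
  by left; apply: tree_lt_caret.
by right; rewrite e; split => //; apply: le_compat.
Qed.

Lemma bi_pos_prod n (S T U : tree n.+1) (f g : C n) :
  bi_pos (Diagram S f T) -> bi_pos (Diagram T g U) -> bi_pos (Diagram S (f * g) U).
Proof.
rewrite /bi_pos /=; move=> [ST|[-> hf]] [TU|[<- hg]].
- by left; apply: tree_lt_trans TU.
- by left.
- by left.
- by right; split => //; apply: strict_mul => //; apply: le_left.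
Qed.

Lemma bi_pos_one n (S : tree n.+1) : ~ bi_pos (Diagram S (1 : C n) S).
Proof. by case=> /= [|[_ /andP[/eqP]]]; rewrite ?tree_ltxx. Qed.

Lemma bi_pos_trichotomy n (S T : tree n.+1) (g : C n) :
  [\/ S = T /\ g = 1, bi_pos (Diagram S g T) | bi_pos (Diagram T g^-1 S)].
Proof.
have [->|h|h] := tree_lt_trichotomy S T; last 2 first.
- by constructor 2; left.
- by constructor 3; left.
have [->|h|h] := strict_trichotomy (le_left n) g.
- by constructor 1.
- by constructor 2; right.
- by constructor 3; right.
Qed.

Lemma class_bi_posC (x y : thompson C) :
  class_pos bi_pos (x * y) -> class_pos bi_pos (y * x).
Proof.
have [_ [n [S [T [U [f [g [-> -> _]]]]]]]] := is_prod_ex x y.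
have -> : dclass S f T * dclass T g U = dclass S (f * g) U by exact: thompson_mulE.
move/(class_posE bi_pos_expand bi_pos_prod bi_pos_one bi_pos_trichotomy).
(* If [S = U], then [y * x] is the class of [Diagram T (g * f) T], and bi-invariance in the group
   [C n] applies. *)
case=> /= [SU|[eSU h]]; last first.
  subst U; have -> : dclass T g S * dclass S f T = dclass T (g * f) T.
    exact: thompson_mulE.
  apply: class_posI; right; split => //=.
  by case: (le_bi n) => _ _ r; apply: strict_conj => //; apply: le_left.
(* If [S < U], expand [y] and [x] until they meet in [B], the common refinement of [U] and [S]. *)
have [e1 de1 v1] := @exp_ex_plus C (Diagram T g U) _ (sub_supl (val U) (val S)).
have [e2 de2 v2] := @exp_ex_minus C (Diagram S f T) _ (sub_supr (val U) (val S)).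
have [|l [A [B [D [a [b [E1 E2]]]]]]] := @dprod_ex C e1 e2; first by rewrite v1 v2.
subst e1 e2; rewrite (dclass_exp de1) (dclass_exp de2) /=.
have -> : dclass A a B * dclass B b D = dclass A (a * b) D by exact: thompson_mulE.
apply: class_posI; left; rewrite /tree_lt /=.
have [fs [/= s1 -> eB]] := pure_expansion_graft de1.
have [fs' [/= s2 eB' ->]] := pure_expansion_graft de2.
(* [B] is both [S] with [fs'] and [U] with [fs] attached, while the outer trees are [T] with [fs]
   and [T] with [fs'] attached. *)
apply: (lexlt_graft_swap _ _ _ _ SU); rewrite ?size_tree_depths //.
by rewrite -eB -eB'.
Qed.

Lemma thompson_bi_orderable : bi_orderable (thompson C).
Proof.
exists (cone_le (class_pos bi_pos)); apply: cone_bi_ordering.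
- exact: class_posM bi_pos_expand bi_pos_prod.
- exact: class_pos1 bi_pos_expand bi_pos_one.
- exact: class_pos_trichotomy bi_pos_trichotomy.
- exact: class_bi_posC.
Qed.

End BiOrdering.

Theorem proposition1p1 (C : cloning_system) :
  ((exists le : forall n : nat, rel (C n),
      (forall n : nat, left_ordering (le n)) /\ compatible le) ->
   left_orderable (thompson C))
  /\
  (pure C ->
   (exists le : forall n : nat, rel (C n),
      (forall n : nat, bi_ordering (le n)) /\ compatible le) ->
   bi_orderable (thompson C)).
Proof.
split=> [[le [le_left le_compat]]|C_pure [le [le_bi le_compat]]].
  exact: thompson_left_orderable le_left le_compat.
exact: thompson_bi_orderable C_pure le_bi le_compat.
Qed.
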